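(* Let $\rho:\Gamma\to G$ be a $(P^+,P^-)$-Anosov representation, let $M:=\Omega_\rho$ be its domain of discontinuity, and for $g\in\rho(\Gamma)$ let $E^g=g^*TM$ and let $\mathcal{D}^{E^g}$ be the space of all connections on $E^g$, topologized as in the context. Then $\rho(\Gamma)$ acts properly discontinuously on the disjoint union $\coprod_{g\in\rho(\Gamma)}\mathcal{D}^{E^g}$.
   Context: Anosov representations. $\Gamma$ is a finitely generated word hyperbolic group with boundary $\partial_\infty\Gamma$, and $\partial_\infty\Gamma^{(2)}=\partial_\infty\Gamma\times\partial_\infty\Gamma\setminus\{(t,t)\}$. $G$ is a semisimple Lie group, $(P^+,P^-)$ a pair of opposite parabolic subgroups, $\mathcal{F}^\pm=G/P^\pm$. A pair in $\mathcal{F}^+\times\mathcal{F}^-$ is transverse if it lies in the unique open $G$-orbit of the diagonal action (this orbit is $\cong G/(P^+\cap P^-)$). $\hat\Gamma$ is the (essentially unique) proper hyperbolic metric space with an action of $\Gamma\times(\mathbb{R}\rtimes\mathbb{Z}/2\mathbb{Z})$ such that $\Gamma\times\mathbb{Z}/2\mathbb{Z}$ acts isometrically, every orbit map $\Gamma\to\hat\Gamma$ is a quasi-isometry, the $\mathbb{R}$-action $\phi_t$ is free with quasi-isometrically embedded orbits, and the induced map $(\tau^+,\tau^-):\hat\Gamma/\mathbb{R}\to\partial_\infty\Gamma^{(2)}$ (endpoints of orbits) is a homeomorphism. A representation $\rho:\Gamma\to G$ is $(P^+,P^-)$-Anosov if there are continuous $\rho$-equivariant maps $\xi^\pm:\partial_\infty\Gamma\to\mathcal{F}^\pm$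 such that (1) $(\xi^+(t^+),\xi^-(t^-))$ is transverse for all $(t^+,t^-)\in\partial_\infty\Gamma^{(2)}$; (2) for one (hence any) continuous equivariant family of norms $\|\cdot\|_{\hat m}$, $\hat m\in\hat\Gamma$, on $T_{\xi^+(\tau^+(\hat m))}\mathcal{F}^+$ (resp. $T_{\xi^-(\tau^-(\hat m))}\mathcal{F}^-$) there are $A,a>0$ with $\|e\|_{\phi_{-t}(\hat m)}\le Ae^{-at}\|e\|_{\hat m}$ (resp. $\|e\|_{\phi_t(\hat m)}\le Ae^{-at}\|e\|_{\hat m}$) for all $t\ge0$, $\hat m$, $e$. Domain of discontinuity. $\mathcal{X}=G/H$ with $H$ a parabolic or a symmetric subgroup of $G$. $M=\Omega_\rho\subset\mathcal{X}$ is a domain of discontinuity for $\rho$: an open $\rho(\Gamma)$-invariant subset such that for every compact $K\subset\Omega_\rho$ the set $\{\gamma\in\Gamma:\rho(\gamma)K\cap K\ne\emptyset\}$ is finite. An action of $\rho(\Gamma)$ on a topological space $X$ is called properly discontinuous if for every compact $K\subset X$ the set $\{\gamma\in\Gamma:\rho(\gamma)K\cap K\neq\emptyset\}$ is finite. Bundles and actions. Each $g\in\rho(\Gamma)$ acts on $M$ as a diffeomorphism; $E=TM$, $E^g=g^*TM=\{(m,x)\in M\times TM: x\in T_{gm}M\}$. For $g,g'\in\rho(\Gamma)$ there is a vector bundle isomorphism $g:E^{g'}\to E^{gg'}$ over $\mathrm{id}_M$, given on the fibre over $m$ by $dg|_{g'm}:T_{g'm}M\to T_{gg'm}M$; it induces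 $g:\mathrm{End}(E^{g'})\to\mathrm{End}(E^{gg'})$ by conjugation, and acts on bundle-valued forms by $g(\sum\alpha_i\sigma_i)=\sum\alpha_i\,g(\sigma_i)$ ($\alpha_i$ forms, $\sigma_i$ sections). If $D$ is a connection on $E^{g'}$, then $gD$ is the connection on $E^{gg'}$ with $(gD)(\sum\alpha_i\sigma_i)=g\,D(\sum\alpha_i\,g^{-1}\sigma_i)$. This gives the action of $\rho(\Gamma)$ on $\coprod_g\mathcal{D}^{E^g}$. Topology. $\Omega^1(M;\mathrm{End}(E^g))$ has the topology of pointwise convergence, i.e. the subspace topology from the product $\prod_{m\in M}(T^*M\otimes\mathrm{End}(E^g))$ of copies of the total space of the bundle (a section is identified with the family of its values). Fix a connection $D\in\mathcal{D}^{E}$. Then $\mathcal{D}^{E^g}$ is topologized so that the bijection $\Psi^g:\Omega^1(M;\mathrm{End}(E^g))\to\mathcal{D}^{E^g}$, $A\mapsto gD+A$, is a homeomorphism; $\coprod_g\mathcal{D}^{E^g}$ has the disjoint union topology. *)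

(* Defs.v *)
From HB Require Import structures.
From mathcomp Require Import all_boot all_order all_algebra.
From mathcomp Require Import all_classical all_reals all_analysis.

Set Implicit Arguments.
Unset Strict Implicit.
Unset Printing Implicit Defensive.

Import Order.TTheory GRing.Theory Num.Theory.
Import numFieldNormedType.Exports.

Local Open Scope classical_set_scope.
Local Open Scope ring_scope.

(* Final topology on [T] for [f : S -> T]; dual to [initial_topology]. *)
Definition final_topology {S T : Type} (f : S -> T) : Type := T.

Section FinalTopology.
Context (S : topologicalType) (T : choiceType) (f : S -> T).

Definition final_open : set_system T := [set W | open (f @^-1` W)].

Lemma final_openT : final_open setT.
Proof. by rewrite /final_open /= preimage_setT; exact: openT. Qed.

Lemma final_openI : setI_closed final_open.
Proof.
by move=> A B oA oB; rewrite /final_open /= preimage_setI; exact: openI.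
Qed.

Lemma final_open_bigU (I : Type) (g : I -> set T) :
  (forall i, final_open (g i)) -> final_open (\bigcup_i g i).
Proof.
by move=> og; rewrite /final_open /= preimage_bigcup; apply: bigcup_open => i _; exact: og.
Qed.

HB.instance Definition _ := Choice.copy (final_topology f) T.
HB.instance Definition _ := isOpenTopological.Build (final_topology f)
  final_openT final_openI final_open_bigU.

End FinalTopology.

Definition properly_discontinuous (Gamma : Type) (X : topologicalType)
    (act : Gamma -> X -> X) : Prop :=
  forall K : set X, compact K ->
    finite_set [set gamma | (act gamma @` K) `&` K !=set0].

(* Linear maps between the linear subspaces [S] and [T] of two ambient modules,
   each represented by its extension by 0 outside [S]; they form a subset of
   the ambient module [L -> L'], so that [homs] can be iterated. *)
Definition homs (R : pzRingType) (L L' : lmodType R)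
    (S : set L) (T : set L') : set (L -> L') :=
  [set A | [/\ forall v, ~ S v -> A v = 0,
               forall v, S v -> T (A v) &
               forall a v w, S v -> S w -> A (a *: v + w) = a *: A v + A w]].

(* Class C^k on the open set [U]: the iterated directional derivatives up to
   order k exist and are continuous. *)
Fixpoint Ck (R : realType) (V W : normedModType R) (k : nat)
    (U : set V) (f : V -> W) : Prop :=
  (forall x, U x -> {for x, continuous f}) /\
  if k is k'.+1 then
    forall v, exists2 df : V -> W,
      forall x, U x -> is_derive x v f (df x) & Ck k' U df
  else True.

Definition Cinfty (R : realType) (V W : normedModType R)
    (U : set V) (f : V -> W) : Prop := forall k, Ck k U f.

Record chart (R : realType) (n : nat) (M : topologicalType) := Chart {
  chart_dom : set M;
  chart_map : M -> 'rV[R]_n;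
  chart_inv : 'rV[R]_n -> M;
  chart_dom_open : open chart_dom;
  chart_img_open : open (chart_map @` chart_dom);
  chart_mapK : forall x, chart_dom x -> chart_inv (chart_map x) = x;
  chart_map_continuous : {within chart_dom, continuous chart_map};
  chart_inv_continuous :
    {within chart_map @` chart_dom, continuous chart_inv}
}.

Definition chart_img (R : realType) (n : nat) (M : topologicalType)
    (c : chart R n M) : set 'rV[R]_n := chart_map c @` chart_dom c.

HB.mixin Record isManifold (R : realType) (n : nat) M & Topological M := {
  atlas : set (chart R n M);
  atlas_cover : forall x : M, exists2 c, atlas c & chart_dom c x;
  atlas_compatible : forall c c', atlas c -> atlas c' ->
    Cinfty (chart_map c @` (chart_dom c `&` chart_dom c'))
           (chart_map c' \o chart_inv c);
  manifold_hausdorff : hausdorff_space M;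
  manifold_second_countable : @second_countable M
}.

#[short(type="manifoldType")]
HB.structure Definition Manifold (R : realType) (n : nat) :=
  { M of isManifold R n M & Topological M }.

Section SmoothFunctions.
Context (R : realType).

(* Smooth real functions on the open set [U]; the values off [U] are
   irrelevant. *)
Definition smooth_fun (n : nat) (M : manifoldType R n)
    (U : set M) (f : M -> R) : Prop :=
  forall c, @atlas R n M c ->
    Cinfty (chart_img c `&` (chart_inv c @^-1` U)) (f \o chart_inv c).

(* The same on an open subset of the product manifold, for the product
   charts. *)
Definition smooth_fun2 (n n' : nat) (M : manifoldType R n)
    (M' : manifoldType R n') (U : set (M * M')) (f : M * M' -> R) : Prop :=
  forall c c', @atlas R n M c -> @atlas R n' M' c' ->
    let inv2 := fun z => (chart_inv c z.1, chart_inv c' z.2) in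
    Cinfty ((chart_img c `*` chart_img c') `&` (inv2 @^-1` U)) (f \o inv2).

(* Smoothness of maps is expressed by pulling back smooth functions. *)
Definition smooth_map (n n' : nat) (M : manifoldType R n)
    (N : manifoldType R n') (F : M -> N) : Prop :=
  continuous F /\
  forall (U : set N) (f : N -> R), open U -> smooth_fun U f ->
    smooth_fun (F @^-1` U) (f \o F).

End SmoothFunctions.

HB.mixin Record isLieGroup (R : realType) (n : nat) G
    & Manifold R n G & Group G := {
  mulg_continuous : continuous (fun z : G * G => (z.1 * z.2)%g);
  mulg_smooth : forall (U : set G) (f : G -> R), open U -> smooth_fun U f ->
    smooth_fun2 ((fun z : G * G => (z.1 * z.2)%g) @^-1` U)
                (fun z : G * G => f (z.1 * z.2)%g);
  invg_smooth : smooth_map (fun x : G => (x^-1)%g)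
}.

#[short(type="lieGroupType")]
HB.structure Definition LieGroup (R : realType) (n : nat) :=
  { G of isLieGroup R n G & Manifold R n G & Group G }.

(* Here a manifold enters only through its set [M] of points and its
   algebra [C] of smooth functions.  All tangent spaces live in the same
   ambient module [(M -> R) -> R], a tangent vector being a derivation of [C]
   (extended by 0 outside [C]).  Smoothness of sections is tested against
   functions in [C], that of forms against smooth sections. *)

Section Bundles.
Context (R : realType) (M : Type) (C : set (M -> R)).

Definition ambient : Type := (M -> R) -> R^o.
HB.instance Definition _ := GRing.Lmodule.copy ambient ((M -> R) -> R^o).

Definition tangent (m : M) : set ambient :=
  [set e : ambient |
    [/\ forall f, ~ C f -> e f = 0,
        forall a f g, C f -> C g -> e (fun x => a * f x + g x) = a * e f + e g &
        forall f g, C f -> C g ->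
          e (fun x => f x * g x) = f m * e g + g m * e f]].

Definition differential (h : M -> M) (e : ambient) : ambient :=
  fun f => e (f \o h).

(* Smooth sections of u^*TM, for [u : M -> M]. *)
Definition sections (u : M -> M) : set (M -> ambient) :=
  [set s | (forall m, tangent (u m) (s m)) /\
           (forall f, C f -> C (fun m => s m f))].

(* Omega^1(M; u^*TM) *)
Definition forms (u : M -> M) : set (M -> ambient -> ambient) :=
  [set A | (forall m, homs (tangent m) (tangent (u m)) (A m)) /\
           (forall X, sections id X -> sections u (fun m => A m (X m)))].

(* The fibre at [m] of T^*M (x) End(u^*TM). *)
Definition end_fibre (u : M -> M) (m : M) :
    set (ambient -> ambient -> ambient) :=
  homs (tangent m) (homs (tangent (u m)) (tangent (u m))).

(* Omega^1(M; End(u^*TM)) *)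
Definition end_forms (u : M -> M) : set (M -> ambient -> ambient -> ambient) :=
  [set B | (forall m, end_fibre u m (B m)) /\
           (forall X s, sections id X -> sections u s ->
              sections u (fun m => B m (X m) (s m)))].

(* Connections on u^*TM, as operators from sections to 1-forms (extended by 0
   to non-smooth families of vectors).  The differential of a function [f] is
   [v |-> v f]. *)
Definition connections (u : M -> M) :
    set ((M -> ambient) -> M -> ambient -> ambient) :=
  [set D | [/\ forall s, ~ sections u s -> D s = 0,
               forall s, sections u s -> forms u (D s),
               forall s s', sections u s -> sections u s' ->
                 D (s + s') = D s + D s' &
               forall f s, C f -> sections u s ->
                 forall m v, tangent m v ->
                   D (fun p => f p *: s p) m v
                   = v f *: s m + f m *: D s m v]].

(* [g D = g o D o g^-1] for a diffeomorphism [h] of inverse [h'], which acts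
   on fibres by the differential and trivially on the base. *)
Definition push_conn (h h' : M -> M)
    (D : (M -> ambient) -> M -> ambient -> ambient) :
    (M -> ambient) -> M -> ambient -> ambient :=
  fun s m v => differential h (D (fun p => differential h' (s p)) m v).

(* [D + A] for a connection [D] and an End-valued 1-form [A]. *)
Definition shift_conn (u : M -> M)
    (D : (M -> ambient) -> M -> ambient -> ambient)
    (A : M -> ambient -> ambient -> ambient) :
    (M -> ambient) -> M -> ambient -> ambient :=
  fun s m v => if `[< sections u s >] then D s m v + A m v (s m) else 0.

End Bundles.

Section PushConnection.
Context (R : realType) (M : Type) (C : set (M -> R)).
Context (h h' : M -> M) (hK : cancel h h') (h'K : cancel h' h).
Context (Ch : forall f, C f -> C (f \o h)) (Ch' : forall f, C f -> C (f \o h')).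

Local Notation V := (ambient R M).

Lemma tangent_differential (k k' : M -> M) (m : M) (e : V) :
  cancel k' k -> (forall f, C f -> C (f \o k)) ->
  (forall f, C f -> C (f \o k')) ->
  tangent C m e -> tangent C (k m) (differential k e).
Proof.
move=> kK Ck_ Ck'_ [e0 eL eM]; split=> [f nCf|a f g Cf Cg|f g Cf Cg].
- apply: e0 => /Ck'_; rewrite -compA.
  by rewrite (_ : k \o k' = id) //; apply/funext => x /=; rewrite kK.
- exact: (eL a _ _ (Ck_ _ Cf) (Ck_ _ Cg)).
- exact: (eM _ _ (Ck_ _ Cf) (Ck_ _ Cg)).
Qed.

Lemma sections_differential (u : M -> M) (k k' : M -> M) (s : M -> V) :
  cancel k' k -> (forall f, C f -> C (f \o k)) ->
  (forall f, C f -> C (f \o k')) ->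
  sections C u s -> sections C (k \o u) (fun p => differential k (s p)).
Proof.
move=> kK Ck_ Ck'_ [sT sC]; split=> [m|f Cf].
  exact: (tangent_differential kK Ck_ Ck'_ (sT m)).
exact: (sC _ (Ck_ _ Cf)).
Qed.

Lemma sections_pull (u : M -> M) (s : M -> V) :
  sections C (h \o u) s -> sections C u (fun p => differential h' (s p)).
Proof.
move=> /(sections_differential hK Ch' Ch).
by rewrite (_ : h' \o (h \o u) = u) //; apply/funext => x /=; rewrite hK.
Qed.

Lemma differentialK (e : V) : differential h (differential h' e) = e.
Proof.
apply/funext => f; rewrite /differential -compA.
by congr (e _); apply/funext => x /=; rewrite h'K.
Qed.

Lemma differential0 (k : M -> M) : differential k (0 : V) = 0.
Proof. by []. Qed.

Lemma differential_linear (k : M -> M) (a : R) (e e' : V) :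
  differential k (a *: e + e') = a *: differential k e + differential k e'.
Proof. by []. Qed.

Lemma push_connP (u : M -> M) D : connections C u D ->
  connections C (h \o u) (push_conn h h' D).
Proof.
move=> [D0 DF DD DL]; split=> [s ns|s ss|s s' ss ss'|f s Cf ss m v Tv].
- apply/funext => m; apply/funext => v; rewrite /push_conn D0 //.
  move=> /(sections_differential h'K Ch Ch'); congr (~ (sections _ _ _)): ns.
  by apply/funext => p; rewrite differentialK.
- have [DT DS] := DF _ (sections_pull ss); split=> [m|X sX].
    have [DT0 DTT DTl] := DT m; split=> [v nTv|v Tv|a v w Tv Tw].
    + by rewrite /push_conn DT0.
    + exact: (tangent_differential h'K Ch Ch' (DTT _ Tv)).
    + by rewrite /push_conn DTl.
  exact: (sections_differential h'K Ch Ch' (DS _ sX)).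
- rewrite /push_conn; apply/funext => m; apply/funext => v.
  have := DD _ _ (sections_pull ss) (sections_pull ss').
  move=> /(congr1 (fun F => F m v)) E.
  transitivity (differential h
    (D ((fun p => differential h' (s p)) + (fun p => differential h' (s' p))) m v)).
    by [].
  by rewrite E.
- rewrite /push_conn.
  have E := DL _ _ Cf (sections_pull ss) m v Tv.
  transitivity (differential h
    (D (fun p => f p *: differential h' (s p)) m v)); first by [].
  by rewrite E differential_linear differentialK.
Qed.

End PushConnection.

Section ShiftConnection.
Context (R : realType) (M : Type) (C : set (M -> R)).
Context (CD : forall f g, C f -> C g -> C (fun x => f x + g x)).
Context (CM : forall f g, C f -> C g -> C (fun x => f x * g x)).

Local Notation V := (ambient R M).

Lemma tangentD (m : M) (e e' : V) :
  tangent C m e -> tangent C m e' -> tangent C m (e + e').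
Proof.
move=> [e0 eL eM] [e0' eL' eM']; split=> [f nCf|a f g Cf Cg|f g Cf Cg].
- by rewrite -[LHS]/(e f + e' f) e0 ?e0' ?addr0.
- rewrite -[LHS]/(e _ + e' _) eL ?eL' //.
  by rewrite -[(e + e') f]/(e f + e' f) -[(e + e') g]/(e g + e' g) mulrDr addrACA.
- rewrite -[LHS]/(e _ + e' _) eM ?eM' //.
  by rewrite -[(e + e') f]/(e f + e' f) -[(e + e') g]/(e g + e' g) !mulrDr addrACA.
Qed.

Lemma tangentZ (m : M) (a : R) (e : V) :
  tangent C m e -> tangent C m (a *: e).
Proof.
move=> [e0 eL eM]; split=> [f nCf|b f g Cf Cg|f g Cf Cg].
- by rewrite -[LHS]/(a * e f) e0 ?mulr0.
- rewrite -[LHS]/(a * e _) eL //.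
  by rewrite -[(a *: e) f]/(a * e f) -[(a *: e) g]/(a * e g) mulrDr mulrCA.
- rewrite -[LHS]/(a * e _) eM //.
  rewrite -[(a *: e) f]/(a * e f) -[(a *: e) g]/(a * e g) mulrDr.
  by rewrite !(mulrCA a).
Qed.

Lemma sectionsD (u : M -> M) (s s' : M -> V) : sections C u s ->
  sections C u s' -> sections C u (s + s').
Proof.
move=> [sT sC] [sT' sC']; split=> [m|f Cf]; first exact: tangentD.
exact: (CD (sC _ Cf) (sC' _ Cf)).
Qed.

Lemma shift_connP (u : M -> M) D B : connections C u D ->
  end_forms C u B -> connections C u (shift_conn C u D B).
Proof.
move=> [D0 DF DD DL] [BT BS]; split=> [s ns|s ss|s s' ss ss'|f s Cf ss m v Tv].
- by apply/funext => m; apply/funext => v; rewrite /shift_conn asboolF.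
- have [DT DS] := DF _ ss.
  have [sT _] := ss.
  split=> [m|X sX].
    have [DT0 DTT DTl] := DT m; have [B0 BTT Bl] := BT m.
    split=> [v nTv|v Tv|a v w Tv Tw]; rewrite /shift_conn asboolT //.
    + by rewrite DT0 // B0 // addr0.
    + apply: tangentD; first exact: DTT.
      by have [_ + _] := BTT _ Tv; apply.
    + rewrite DTl // Bl //.
      rewrite -[(a *: B m v + B m w) (s m)]/(a *: B m v (s m) + B m w (s m)).
      by rewrite scalerDr addrACA.
  rewrite (_ : (fun m => _) =
      (fun m => D s m (X m)) + (fun m => B m (X m) (s m))); last first.
    by apply/funext => m; rewrite /shift_conn asboolT.
  by apply: sectionsD; [exact: DS|exact: BS].
- apply/funext => m; apply/funext => v.
  have sss := sectionsD ss ss'.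
  rewrite -[RHS]/(shift_conn C u D B s m v + shift_conn C u D B s' m v).
  rewrite /shift_conn !asboolT // DD //.
  rewrite -[(D s + D s') m v]/(D s m v + D s' m v) addrACA; congr (_ + _).
  have [B0 BTT _] := BT m.
  have [Tv|nTv] := pselect (tangent C m v); last first.
    by rewrite (B0 _ nTv) addr0.
  have [_ _ Bl] := BTT _ Tv.
  have := Bl 1 (s m) (s' m) (ss.1 m) (ss'.1 m).
  by rewrite !scale1r.
- have [B0 BTT _] := BT m; have [_ _ Bl] := BTT _ Tv.
  have fs : sections C u (fun p => f p *: s p).
    split=> [p|g Cg]; first exact/tangentZ/(ss.1 p).
    exact: CM Cf (ss.2 _ Cg).
  rewrite /shift_conn !asboolT // DL // -addrA scalerDr; congr (_ + (_ + _)).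
  have := Bl (f m - 1) (s m) (s m) (ss.1 m) (ss.1 m).
  rewrite -[X in _ = _ + X]scale1r -scalerDl subrK.
  by rewrite scalerBl scale1r subrK.
Qed.

End ShiftConnection.

Section SmoothClosure.
Context (R : realType).

Lemma CkS (V W : normedModType R) k (U : set V) (f : V -> W) :
  Ck k.+1 U f -> Ck k U f.
Proof.
elim: k f => [|k IH] f [cf df]; first by split.
by split=> // v; have [g dg Cg] := df v; exists g => //; exact: IH.
Qed.

Lemma CkD (V W : normedModType R) k (U : set V) (f g : V -> W) :
  Ck k U f -> Ck k U g -> Ck k U (fun x => f x + g x).
Proof.
elim: k f g => [|k IH] f g [cf df] [cg dg].
  by split=> // x Ux; apply: cvgD; [exact: cf|exact: cg].
split=> [x Ux|v]; first by apply: cvgD; [exact: cf|exact: cg].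
have [f' df' Cf'] := df v; have [g' dg' Cg'] := dg v.
exists (fun x => f' x + g' x); last exact: IH.
by move=> x Ux; apply: is_deriveD; [exact: df'|exact: dg'].
Qed.

Lemma CkM (V : normedModType R) k (U : set V) (f g : V -> R) :
  Ck k U f -> Ck k U g -> Ck k U (fun x => f x * g x).
Proof.
elim: k f g => [|k IH] f g Cf Cg.
  by split=> // x Ux; apply: cvgM; [exact: Cf.1|exact: Cg.1].
split=> [x Ux|v]; first by apply: cvgM; [exact: Cf.1|exact: Cg.1].
have [f' df' Cf'] := Cf.2 v; have [g' dg' Cg'] := Cg.2 v.
exists (fun x => f x * g' x + g x * f' x).
  by move=> x Ux; apply: is_deriveM; [exact: df'|exact: dg'].
by apply: CkD; apply: IH => //; exact: CkS.
Qed.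

Lemma Ck_slice (V V' W : normedModType R) k (U : set (V * V')) (f : V * V' -> W)
    (a : V) :
  Ck k U f -> Ck k [set y | U (a, y)] (fun y => f (a, y)).
Proof.
elim: k f => [|k IH] f [cf df].
  split=> // y Uy; apply: (@continuous_comp _ _ _ (pair a) f); last exact: cf.
  by apply: cvg_pair => /=; [exact: cvg_cst|exact: cvg_id].
split=> [y Uy|v].
  apply: (@continuous_comp _ _ _ (pair a) f); last exact: cf.
  by apply: cvg_pair => /=; [exact: cvg_cst|exact: cvg_id].
have [g dg Cg] := df (0, v); exists (fun y => g (a, y)); last exact: IH.
move=> y Uy; have [ex val] := dg _ Uy.
have E : (fun h : R => h^-1 *: (((fun y0 => f (a, y0)) \o shift y) (h *: v) - f (a, y)))
   = (fun h : R => h^-1 *: ((f \o shift (a, y)) (h *: (0, v)) - f (a, y))).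
  apply/funext => h /=; congr (_ *: (f _ - _)).
  by rewrite -[RHS]/(h *: (0 : V) + a, h *: v + y) scaler0 add0r.
split.
  by move: ex; rewrite /derivable E.
by rewrite -val /derive E.
Qed.

Lemma smooth_funD n (M : manifoldType R n) (U : set M) (f g : M -> R) :
  smooth_fun U f -> smooth_fun U g -> smooth_fun U (fun x => f x + g x).
Proof. by move=> sf sg c ac k; apply: CkD; [exact: sf|exact: sg]. Qed.

Lemma smooth_funM n (M : manifoldType R n) (U : set M) (f g : M -> R) :
  smooth_fun U f -> smooth_fun U g -> smooth_fun U (fun x => f x * g x).
Proof. by move=> sf sg c ac k; apply: CkM; [exact: sf|exact: sg]. Qed.

Lemma smooth_fun_translate n (G : lieGroupType R n) (g : G) (U : set G)
    (f : G -> R) : open U -> smooth_fun U f ->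
  smooth_fun ((fun x => (g * x)%g) @^-1` U) (fun x => f (g * x)%g).
Proof.
move=> oU sf c' ac' k.
have [c ac cg] := @atlas_cover R n G g.
have := Ck_slice (chart_map c g) (@mulg_smooth R n G U f oU sf c c' ac ac' k).
rewrite /=; congr Ck.
  apply/seteqP; split=> y /=; rewrite chart_mapK //.
    by move=> [[_ ?] ?].
  by move=> [? ?]; split=> //; split=> //; exists g.
by apply/funext => y /=; rewrite chart_mapK.
Qed.

End SmoothClosure.

Section LieAlgebra.
Context (R : realType) (n : nat) (G : lieGroupType R n).

Definition Cinfty_group : set (G -> R) := [set f | smooth_fun setT f].
Local Notation C := Cinfty_group.

Definition operator : Type := (G -> R) -> G -> R^o.
HB.instance Definition _ := GRing.Lmodule.copy operator ((G -> R) -> G -> R^o).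

(* Left-invariant vector fields, as derivations of C^oo(G) (extended by 0
   outside C^oo(G)). *)
Definition lie_algebra : set operator :=
  [set X : operator |
    [/\ forall f, ~ C f -> X f = 0,
        forall f, C f -> C (X f),
        forall a f g, C f -> C g ->
          X (fun x => a * f x + g x) = (fun x => a * X f x + X g x),
        forall f g, C f -> C g ->
          X (fun x => f x * g x) = (fun x => f x * X g x + g x * X f x) &
        forall g f, C f -> X (fun x => f (g * x)%g) = (fun x => X f (g * x)%g)]].

Definition bracket (X Y : operator) : operator :=
  fun f x => X (Y f) x - Y (X f) x.

Definition is_ideal (I : set operator) : Prop :=
  [/\ I `<=` lie_algebra, I 0,
      forall a X Y, I X -> I Y -> I (a *: X + Y) &
      forall X Y, lie_algebra X -> I Y -> I (bracket X Y)].

(* The only abelian ideal of the Lie algebra is 0. *)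
Definition semisimple : Prop :=
  forall I, is_ideal I -> (forall X Y, I X -> I Y -> bracket X Y = 0) ->
    I `<=` [set 0].

Definition Ad (g : G) (X : operator) : operator :=
  fun f x => X (fun y => f (y * g^-1)%g) (x * g)%g.

(* The sum of the eigenspaces of [ad Z] with eigenvalue in [L]. *)
Definition ad_eigensum (Z : operator) (L : set R) : set operator :=
  [set X | exists (k : nat) (lambda : 'I_k -> R) (Y : 'I_k -> operator),
     (forall i, [/\ L (lambda i), lie_algebra (Y i) &
                    bracket Z (Y i) = lambda i *: Y i]) /\
     X = \sum_(i < k) Y i].

Definition ad_diagonalizable (Z : operator) : Prop :=
  lie_algebra `<=` ad_eigensum Z setT.

(* Parabolic subgroups of a real semisimple Lie group are the normalizers of
   the subalgebras p_Z, the sums of the eigenspaces of ad Z with nonnegative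
   eigenvalues, for Z in the Lie algebra with ad Z diagonalizable over R (that
   is, Z in some Cartan subspace); the opposite of the one given by Z is the
   one given by -Z. *)
Definition parabolic_of (Z : operator) : set G :=
  [set g | Ad g @` ad_eigensum Z [set l | 0 <= l]
           = ad_eigensum Z [set l | 0 <= l]].

Definition parabolic (P : set G) : Prop :=
  exists Z, [/\ lie_algebra Z, ad_diagonalizable Z & P = parabolic_of Z].

Definition opposite_parabolics (Pp Pm : set G) : Prop :=
  exists Z, [/\ lie_algebra Z, ad_diagonalizable Z,
                Pp = parabolic_of Z & Pm = parabolic_of (- Z)].

(* A subgroup between the identity component of the fixed group of an
   involutive automorphism and the whole fixed group. *)
Definition symmetric_subgroup (H : set G) : Prop :=
  [/\ H 1%g, forall x y, H x -> H y -> H (x * y)%g,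
      forall x, H x -> H (x^-1)%g &
      exists sigma : G -> G,
        [/\ forall x y, sigma (x * y)%g = (sigma x * sigma y)%g,
            smooth_map sigma, involutive sigma,
            H `<=` [set x | sigma x = x] &
            connected_component [set x | sigma x = x] 1%g `<=` H]].

End LieAlgebra.

Section Homogeneous.
Context (R : realType) (n : nat) (G : lieGroupType R n) (H : set G).

Definition left_coset (x : G) : set G := [set (x * h)%g | h in H].

Definition coset_type : Type := set_type [set A | exists x, A = left_coset x].
HB.instance Definition _ := Choice.on coset_type.

Definition coset_of (x : G) : coset_type :=
  SigSub (mem_set (ex_intro _ x erefl) :
            left_coset x \in [set A | exists x, A = left_coset x]).

Definition coset : Type := final_topology coset_of.
HB.instance Definition _ := Topological.on coset.

Definition coset_pi (x : G) : coset := coset_of x.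

Lemma coset_pi_surj (A : coset) : exists x, A = coset_pi x.
Proof.
have [x Ax] := set_mem (valP (A : coset_type)).
by exists x; apply: (val_inj : injective (val : coset_type -> _)).
Qed.

Fact translate_subproof (g : G) (A : coset) :
  [set (g * x)%g | x in val (A : coset_type)]
    \in [set A | exists x, A = left_coset x].
Proof.
apply/mem_set; have [x ->] := coset_pi_surj A; exists (g * x)%g.
by rewrite /= /left_coset image_comp; apply: eq_imagel => h _ /=; rewrite mulgA.
Qed.

Definition translate (g : G) (A : coset) : coset :=
  SigSub (translate_subproof g A) : coset_type.

Lemma translate_pi g x : translate g (coset_pi x) = coset_pi (g * x)%g.
Proof.
apply: val_inj => /=; rewrite /left_coset image_comp.
by apply: eq_imagel => h _ /=; rewrite mulgA.
Qed.

Lemma translateM g g' A : translate (g * g')%g A = translate g (translate g' A).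
Proof.
by have [x ->] := coset_pi_surj A; rewrite !translate_pi mulgA.
Qed.

Lemma translate1 A : translate 1%g A = A.
Proof. by have [x ->] := coset_pi_surj A; rewrite translate_pi mul1g. Qed.

(* C^oo(U) for [U] open in G/H: the smooth structure of G/H is the one for which
   a function is smooth iff its pull-back to G is. *)
Definition Cinfty_coset (U : set coset) : set (set_type U -> R) :=
  [set f | exists2 F : G -> R, smooth_fun (coset_pi @^-1` U) F &
     forall x (m : set_type U), coset_pi x = set_val m -> F x = f m].

Definition Cinfty_quot : set (coset -> R) :=
  [set f : coset -> R | smooth_fun setT (fun x => f (coset_pi x))].

Lemma CinftyD_coset (U : set coset) (f g : set_type U -> R) :
  Cinfty_coset f -> Cinfty_coset g -> Cinfty_coset (fun m => f m + g m).
Proof.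
move=> [F sF EF] [F' sF' EF']; exists (fun x => F x + F' x).
  exact: smooth_funD.
by move=> x m xm; rewrite (EF _ _ xm) (EF' _ _ xm).
Qed.

Lemma CinftyM_coset (U : set coset) (f g : set_type U -> R) :
  Cinfty_coset f -> Cinfty_coset g -> Cinfty_coset (fun m => f m * g m).
Proof.
move=> [F sF EF] [F' sF' EF']; exists (fun x => F x * F' x).
  exact: smooth_funM.
by move=> x m xm; rewrite (EF _ _ xm) (EF' _ _ xm).
Qed.

End Homogeneous.

Section Hyperbolic.
Context (R : realType).

Definition gromov_product (X : Type) (d : X -> X -> R) (o x y : X) : R :=
  (d x o + d y o - d x y) / 2.

Definition gromov_hyperbolic (X : Type) (d : X -> X -> R) : Prop :=
  exists delta : R, forall o x y z,
    Num.min (gromov_product d o x y) (gromov_product d o y z) - delta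
    <= gromov_product d o x z.

Definition quasi_isometric_embedding (X Y : Type) (dX : X -> X -> R)
    (dY : Y -> Y -> R) (f : X -> Y) : Prop :=
  exists L K : R, 1 <= L /\ 0 <= K /\
    forall x x', dX x x' / L - K <= dY (f x) (f x') <= L * dX x x' + K.

Definition quasi_isometry (X Y : Type) (dX : X -> X -> R)
    (dY : Y -> Y -> R) (f : X -> Y) : Prop :=
  quasi_isometric_embedding dX dY f /\
  exists K : R, forall y, exists x, dY (f x) y <= K.

Context (Gamma : groupType) (S : seq Gamma).

Definition words (g : Gamma) : set (seq Gamma) :=
  [set w | all (fun s => (s \in S) || ((s^-1)%g \in S)) w /\
           (\prod_(s <- w) s)%g = g].

Definition generating : Prop := forall g, words g !=set0.

Definition word_dist (g g' : Gamma) : R :=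
  inf [set (size w)%:R | w in words (g^-1 * g')%g].

Definition word_hyperbolic : Prop :=
  generating /\ gromov_hyperbolic word_dist.

Local Notation gp := (gromov_product word_dist 1%g).

Definition asymptotic (x y : nat -> Gamma) : Prop :=
  forall N : R, exists k, forall i j, (k <= i)%N -> (k <= j)%N ->
    N <= gp (x i) (y j).

(* Points of the boundary are the classes of sequences converging to infinity
   under [asymptotic]. *)
Definition is_boundary_point (p : set (nat -> Gamma)) : Prop :=
  exists2 x, asymptotic x x & p = [set y | asymptotic y y /\ asymptotic x y].

Definition boundary : Type := set_type is_boundary_point.
HB.instance Definition _ := Choice.on boundary.

Definition converges_to (x : nat -> Gamma) (p : boundary) : Prop := set_val p x.

(* Basic neighbourhoods: points q such that liminf (x_i|y_j) >= r for some
   sequences x, y converging to p, q. *)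
Definition boundary_nbhd (p : boundary) (r : R) : set boundary :=
  [set q | exists x y, [/\ converges_to x p, converges_to y q &
     forall eps : R, 0 < eps -> exists k, forall i j, (k <= i)%N -> (k <= j)%N ->
       r - eps <= gp (x i) (y j)]].

Definition boundary_open : set_system boundary :=
  [set W | forall p, W p -> exists r, boundary_nbhd p r `<=` W].

Lemma boundary_openT : boundary_open setT.
Proof. by move=> p _; exists 0. Qed.

Lemma boundary_nbhd_le p (r r' : R) : r <= r' ->
  boundary_nbhd p r' `<=` boundary_nbhd p r.
Proof.
move=> rr' q [x [y [xp yq H]]]; exists x, y; split=> // eps e0.
have [k Hk] := H _ e0; exists k => i j ki kj.
by apply: le_trans (Hk _ _ ki kj); rewrite lerD2r.
Qed.

Lemma boundary_openI : setI_closed boundary_open.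
Proof.
move=> A B oA oB p [Ap Bp].
have [r rA] := oA _ Ap; have [r' rB] := oB _ Bp.
exists (Num.max r r') => q Hq; split.
  by apply/rA/(boundary_nbhd_le _ Hq); rewrite le_max lexx.
by apply/rB/(boundary_nbhd_le _ Hq); rewrite le_max lexx orbT.
Qed.

Lemma boundary_open_bigU (I : Type) (g : I -> set boundary) :
  (forall i, boundary_open (g i)) -> boundary_open (\bigcup_i g i).
Proof.
move=> og p [i _ /og [r rg]]; exists r => q /rg gq; by exists i.
Qed.

HB.instance Definition _ := isOpenTopological.Build boundary
  boundary_openT boundary_openI boundary_open_bigU.

(* [q = gamma p] *)
Definition boundary_translate (gamma : Gamma) (p q : boundary) : Prop :=
  exists2 x, converges_to x p & converges_to (fun i => (gamma * x i)%g) q.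

End Hyperbolic.

Record flow_space (R : realType) (Gamma : groupType) (S : seq Gamma)
    (X : metricType R) := FlowSpace {
  fs_act : Gamma -> X -> X;
  fs_flow : R -> X -> X;
  fs_flip : X -> X;
  fs_proper : forall (x : X) (r : R), compact [set y | mdist x y <= r];
  fs_hyperbolic : gromov_hyperbolic (@mdist R X);
  (* an action of Gamma x (R x| Z/2Z), given by its three factors *)
  fs_act1 : forall x, fs_act 1%g x = x;
  fs_actM : forall g g' x, fs_act (g * g')%g x = fs_act g (fs_act g' x);
  fs_flow0 : forall x, fs_flow 0 x = x;
  fs_flowD : forall s t x, fs_flow (s + t) x = fs_flow s (fs_flow t x);
  fs_flow_continuous : continuous (fun z : R * X => fs_flow z.1 z.2);
  fs_flipK : involutive fs_flip;
  fs_flip_flow : forall t x, fs_flip (fs_flow t x) = fs_flow (- t) (fs_flip x);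
  fs_act_flow : forall g t x, fs_act g (fs_flow t x) = fs_flow t (fs_act g x);
  fs_act_flip : forall g x, fs_act g (fs_flip x) = fs_flip (fs_act g x);
  fs_act_isometry : forall g x y, mdist (fs_act g x) (fs_act g y) = mdist x y;
  fs_flip_isometry : forall x y, mdist (fs_flip x) (fs_flip y) = mdist x y;
  fs_orbit_qi : forall x,
    quasi_isometry (@word_dist R Gamma S) (@mdist R X) (fun g => fs_act g x);
  fs_flow_free : forall t x, fs_flow t x = x -> t = 0;
  fs_flow_qi : forall x,
    quasi_isometric_embedding (fun s t : R => `|s - t|) (@mdist R X)
      (fun t => fs_flow t x);
  (* endpoints of the R-orbits, under the identification of the boundaries of
     X and Gamma given by the orbit maps *)
  fs_tau_plus : X -> boundary R S;
  fs_tau_minus : X -> boundary R S;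
  fs_tau_plusP : forall x, exists (g : nat -> Gamma) (K : R),
    (forall i, mdist (fs_act (g i) x) (fs_flow i%:R x) <= K) /\
    converges_to g (fs_tau_plus x);
  fs_tau_minusP : forall x, exists (g : nat -> Gamma) (K : R),
    (forall i, mdist (fs_act (g i) x) (fs_flow (- i%:R) x) <= K) /\
    converges_to g (fs_tau_minus x);
  (* they induce a homeomorphism from X/R onto the space of pairs of distinct
     boundary points *)
  fs_tau_flow : forall t x, fs_tau_plus (fs_flow t x) = fs_tau_plus x /\
    fs_tau_minus (fs_flow t x) = fs_tau_minus x;
  fs_tau_inj : forall x y, fs_tau_plus x = fs_tau_plus y ->
    fs_tau_minus x = fs_tau_minus y -> exists t, y = fs_flow t x;
  fs_tau_image : [set (fs_tau_plus x, fs_tau_minus x) | x in setT]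
    = [set pq | pq.1 <> pq.2];
  fs_tau_homeo : forall W : set (boundary R S * boundary R S),
    W `<=` [set pq | pq.1 <> pq.2] ->
    (exists2 O, open O & W = O `&` [set pq | pq.1 <> pq.2]) <->
    open ((fun x => (fs_tau_plus x, fs_tau_minus x)) @^-1` W)
}.

Section Anosov.
Context (R : realType) (n : nat) (G : lieGroupType R n).
Context (Gamma : groupType) (S : seq Gamma).
Context (X : metricType R) (F : flow_space S X) (rho : Gamma -> G).

Definition equivariant (P : set G) (xi : boundary R S -> coset P) : Prop :=
  forall gamma p q, boundary_translate gamma p q ->
    xi q = translate (rho gamma) (xi p).

Definition transverse (Pp Pm : set G) (x : coset Pp) (y : coset Pm) : Prop :=
  open [set (translate g x, translate g y) | g in [set: G]].

Definition flag_tangent (P : set G) (x : coset P) : set (ambient R (coset P)) :=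
  tangent (@Cinfty_quot R n G P) x.

(* A continuous equivariant family of norms on the fibres of f^*T(G/P), for
   [f : X -> G/P].  The total space of f^*T(G/P) carries the topology in which
   a tangent vector varies continuously iff its base point does and all its
   values on smooth functions do. *)
Definition norm_family (P : set G) (f : X -> coset P)
    (N : X -> ambient R (coset P) -> R) : Prop :=
  [/\ forall m e, flag_tangent (f m) e -> 0 <= N m e /\ (N m e = 0 -> e = 0),
      forall m a e, flag_tangent (f m) e -> N m (a *: e) = `|a| * N m e,
      forall m e e', flag_tangent (f m) e -> flag_tangent (f m) e' ->
        N m (e + e') <= N m e + N m e',
      {within [set z : X * {ptws (coset P -> R) -> R} | flag_tangent (f z.1) z.2],
        continuous (fun z : X * {ptws (coset P -> R) -> R} => N z.1 z.2)} &
      forall gamma m e, flag_tangent (f m) e ->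
        N (fs_act F gamma m) (differential (translate (rho gamma)) e) = N m e].

(* Contraction along the flow [theta]; [f] is constant on its orbits. *)
Definition contracting (P : set G) (f : X -> coset P) (theta : R -> X -> X) :
    Prop :=
  exists2 N, norm_family f N & exists A a : R, 0 < A /\ 0 < a /\
    forall t m e, 0 <= t -> flag_tangent (f m) e ->
      N (theta t m) e <= A * expR (- a * t) * N m e.

Definition anosov (Pp Pm : set G) : Prop :=
  exists (xip : boundary R S -> coset Pp) (xim : boundary R S -> coset Pm),
    [/\ continuous xip /\ continuous xim,
        equivariant xip /\ equivariant xim,
        forall p q, p <> q -> transverse (xip p) (xim q),
        contracting (xip \o fs_tau_plus F) (fun t => fs_flow F (- t)) &
        contracting (xim \o fs_tau_minus F) (fs_flow F)].

End Anosov.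

Record domain_of_discontinuity (R : realType) (n : nat) (G : lieGroupType R n)
    (Gamma : groupType) (rho : Gamma -> G) (H : set G) := Domain {
  dod_set :> set (coset H);
  dod_open : open dod_set;
  (* without this the empty set would qualify for every representation *)
  dod_nonempty : dod_set !=set0;
  dod_invariant : forall gamma x,
    dod_set x -> dod_set (translate (rho gamma) x);
  dod_proper : forall K : set (coset H), compact K -> K `<=` dod_set ->
    finite_set [set gamma | (translate (rho gamma) @` K) `&` K !=set0]
}.

Section Connections.
Context (R : realType) (n : nat) (G : lieGroupType R n) (Gamma : groupType).
Context (rho : {multiplicative Gamma -> G}) (H : set G).
Context (Om : domain_of_discontinuity rho H).

Definition image_group : Type := set_type (range rho).
HB.instance Definition _ := Choice.on image_group.

Definition image_of (gamma : Gamma) : image_group :=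
  SigSub (mem_set (imageT rho gamma)).

Lemma image_groupP (g : image_group) : exists gamma, rho gamma = set_val g.
Proof. by have [gamma _ E] := set_mem (valP g); exists gamma. Qed.

Fact image_mul_subproof (g g' : image_group) :
  (set_val g * set_val g')%g \in range rho.
Proof.
have [gamma <-] := image_groupP g; have [gamma' <-] := image_groupP g'.
by apply/mem_set; exists (gamma * gamma')%g => //=; rewrite gmulfM.
Qed.

Definition image_mul (g g' : image_group) : image_group :=
  SigSub (image_mul_subproof g g').

Lemma rho1 : rho 1%g = 1%g.
Proof. by apply: (mulgI (rho 1%g)); rewrite -gmulfM !mulg1. Qed.

Lemma rhoV gamma : rho (gamma^-1)%g = (rho gamma)^-1%g.
Proof. by apply: (mulgI (rho gamma)); rewrite -gmulfM !mulgV rho1. Qed.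

Fact image_inv_subproof (g : image_group) : (set_val g)^-1%g \in range rho.
Proof.
have [gamma <-] := image_groupP g.
by apply/mem_set; exists (gamma^-1)%g => //=; rewrite rhoV.
Qed.

Definition image_inv (g : image_group) : image_group :=
  SigSub (image_inv_subproof g).

Definition dod_type : Type := set_type Om.
HB.instance Definition _ := Topological.copy dod_type (set_type Om).

Fact dod_act_subproof (g : image_group) (m : dod_type) :
  translate (set_val g) (set_val m) \in (Om : set _).
Proof.
have [gamma <-] := image_groupP g.
exact/mem_set/dod_invariant/(set_mem (valP m)).
Qed.

Definition dod_act (g : image_group) (m : dod_type) : dod_type :=
  SigSub (dod_act_subproof g m).

Definition Cinfty_dod : set (dod_type -> R) := @Cinfty_coset R n G H Om.
Local Notation C := Cinfty_dod.

Lemma dod_actM g g' : dod_act (image_mul g g') = dod_act g \o dod_act g'.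
Proof.
by apply/funext => m; apply: val_inj; exact: translateM.
Qed.

Lemma dod_actK g : cancel (dod_act g) (dod_act (image_inv g)).
Proof.
move=> m; apply: val_inj.
rewrite -[LHS]/(translate (set_val g)^-1%g (translate (set_val g) (set_val m))).
by rewrite -translateM mulVg translate1.
Qed.

Lemma dod_actVK g : cancel (dod_act (image_inv g)) (dod_act g).
Proof.
move=> m; apply: val_inj.
rewrite -[LHS]/(translate (set_val g) (translate (set_val g)^-1%g (set_val m))).
by rewrite -translateM mulgV translate1.
Qed.

Lemma Cinfty_dod_act g f : C f -> C (f \o dod_act g).
Proof.
move=> [F sF EF].
exists (fun x => F (set_val g * x)%g); last first.
  move=> x m xm; apply: EF.
  by rewrite -translate_pi xm.
have -> : @coset_pi R n G H @^-1` Om =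
    (fun x => (set_val g * x)%g) @^-1` (@coset_pi R n G H @^-1` Om).
  apply/seteqP; split=> x /= Ox; rewrite -?translate_pi.
    exact: (set_mem (dod_act_subproof g (SigSub (mem_set Ox)))).
  have := set_mem (dod_act_subproof (image_inv g) (SigSub (mem_set Ox))).
  by rewrite -[X in dod_set _ X]/(translate (set_val g)^-1%g _) translate_pi mulKg.
exact: smooth_fun_translate (dod_open Om) sF.
Qed.

(* Connections on E^g = g^*TM. *)
Definition conn_set (g : image_group) := connections C (dod_act g).

(* The connection [g D], on E^(gg') when [D] is a connection on E^g'. *)
Definition gconn (g : image_group) :=
  @push_conn R dod_type (dod_act g) (dod_act (image_inv g)).

Lemma gconnP g u D : connections C u D ->
  connections C (dod_act g \o u) (gconn g D).
Proof.
apply: push_connP; [exact: dod_actK|exact: dod_actVK|exact: Cinfty_dod_act|].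
exact: Cinfty_dod_act.
Qed.

Lemma gconn_setP g g' D : conn_set g' D -> conn_set (image_mul g g') (gconn g D).
Proof. by rewrite /conn_set dod_actM; exact: gconnP. Qed.

Section Topology.
Context (g : image_group).

Local Notation V := (ambient R dod_type).

(* The total space of T^*M (x) End(E^g): a point (m, B) varies continuously iff
   m does and all contractions <B(X_m)s_m, f> do, for X a vector field on M, s a
   section of E^g and f a smooth function on M. *)
Definition end_total : Type :=
  set_type [set mB : dod_type * (V -> V -> V) |
              end_fibre C (dod_act g) mB.1 mB.2].
HB.instance Definition _ := Choice.on end_total.

Definition contraction_index : Type :=
  (set_type (sections C id) * set_type (sections C (dod_act g)) * set_type C)%type.

Definition contractions (mB : end_total) :
    dod_type * {ptws contraction_index -> R} :=
  let m := (set_val mB).1 in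
  (m, fun i => (set_val mB).2 (set_val i.1.1 m) (set_val i.1.2 m) (set_val i.2)).

Definition end_bundle : Type := initial_topology contractions.
HB.instance Definition _ := Topological.on end_bundle.

(* Omega^1(M; End(E^g)) with the topology of pointwise convergence *)
Definition end_form_type : Type := set_type (end_forms C (dod_act g)).
HB.instance Definition _ := Choice.on end_form_type.

Definition end_form_value (B : end_form_type) : {ptws dod_type -> end_bundle} :=
  fun m => SigSub (mem_set ((set_mem (valP B)).1 m)
             : (m, set_val B m) \in [set mB | end_fibre C (dod_act g) mB.1 mB.2])
           : end_total.

Definition end_form_space : Type := initial_topology end_form_value.
HB.instance Definition _ := Topological.on end_form_space.

Definition conn_type : Type := set_type (conn_set g).
HB.instance Definition _ := Choice.on conn_type.

(* The bijection A |-> g D0 + A, for [D0] a connection on E = TM. *)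
Context (D0 : set_type (connections C id)).

Fact Psi_subproof (B : end_form_space) :
  shift_conn C (dod_act g) (gconn g (set_val D0)) (set_val (B : end_form_type))
    \in conn_set g.
Proof.
apply/mem_set/shift_connP; last exact: (set_mem (valP (B : end_form_type))).
- exact: CinftyD_coset.
- exact: CinftyM_coset.
- exact: (gconnP g (set_mem (valP D0))).
Qed.

Definition Psi (B : end_form_space) : conn_type := SigSub (Psi_subproof B).

(* Psi being bijective, this is the topology making it a homeomorphism. *)
Definition conn_space : Type := final_topology Psi.
HB.instance Definition _ := Topological.on conn_space.

End Topology.

Context (D0 : set_type (connections C id)).

Definition conn_coprod : topologicalType := {g : image_group & conn_space g D0}.

Fact conn_act_subproof (g : image_group) (gD : conn_coprod) :
  gconn g (set_val (projT2 gD : conn_type _)) \in conn_set (image_mul g (projT1 gD)).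
Proof.
exact/mem_set/gconn_setP/(set_mem (valP (projT2 gD : conn_type _))).
Qed.

(* (g', D) |-> (g g', g D) *)
Definition conn_act (g : image_group) (gD : conn_coprod) : conn_coprod :=
  existT (fun g' => conn_space g' D0) (image_mul g (projT1 gD))
    (SigSub (conn_act_subproof g gD) : conn_type _).

Lemma conn_coprod_eq (x y : conn_coprod) : projT1 x = projT1 y ->
  set_val (projT2 x : conn_type _) = set_val (projT2 y : conn_type _) -> x = y.
Proof.
case: x y => [g D] [g' D'] /= E; rewrite -{}E in D' *.
move=> DD'; congr existT.
by apply: (val_inj : injective (val : conn_type g -> _)).
Qed.

Lemma conn_act1 (x : conn_coprod) : conn_act (image_of 1%g) x = x.
Proof.
have E1 : dod_act (image_of 1%g) = id.
  apply/funext => m; apply: val_inj.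
  by rewrite -[LHS]/(translate (rho 1%g) (set_val m)) rho1 translate1.
have E2 : dod_act (image_inv (image_of 1%g)) = id.
  apply/funext => m; apply: val_inj.
  rewrite -[LHS]/(translate (rho 1%g)^-1%g (set_val m)).
  by rewrite -rhoV invg1 rho1 translate1.
apply: conn_coprod_eq => /=.
  apply: (val_inj : injective (val : image_group -> _)).
  by rewrite -[LHS]/(rho 1%g * _)%g rho1 mul1g.
rewrite -[LHS]/(gconn (image_of 1%g) (set_val (projT2 x : conn_type _))).
by rewrite /gconn /push_conn E1 E2.
Qed.

Lemma conn_actM (g g' : image_group) (x : conn_coprod) :
  conn_act (image_mul g g') x = conn_act g (conn_act g' x).
Proof.
have E : dod_act (image_inv (image_mul g g')) =
    dod_act (image_inv g') \o dod_act (image_inv g).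
  rewrite -dod_actM; congr dod_act.
  by apply: (val_inj : injective (val : image_group -> _)); exact: invgM.
apply: conn_coprod_eq => /=.
  by apply: (val_inj : injective (val : image_group -> _)); exact/esym/mulgA.
rewrite -[LHS]/(gconn (image_mul g g') (set_val (projT2 x : conn_type _))).
by rewrite /gconn /push_conn E dod_actM.
Qed.

End Connections.

(* Main.v *)
Require Import Defs.
From HB Require Import structures.
From mathcomp Require Import all_boot all_order all_algebra.
From mathcomp Require Import all_classical all_reals all_analysis.

(* A compact subset of the disjoint union meets only finitely many components,
   and a group element carrying one given component to another is determined by
   the pair, so only finitely many elements of the image of [rho] occur.  The
   kernel of [rho] fixes every point of the nonempty domain of discontinuity, so
   proper discontinuity there makes it finite, hence [rho] has finite fibres. *)

Local Open Scope classical_set_scope.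

Lemma compact_locally_constant_finite {T : topologicalType} {J : Type}
    (f : T -> J) (K : set T) :
  (forall p, nbhs p (f @^-1` [set f p])) -> compact K -> finite_set (f @` K).
Proof.
(* Otherwise the sets containing all but finitely many fibres of [f] on [K]
   would form a proper filter without cluster point. *)
move=> fconst cK; apply: contrapT => infK.
pose cofin : set_system T := [set B | exists2 A : set J, finite_set A &
  K `&` f @^-1` (~` A) `<=` B].
have cofin_proper : ProperFilter cofin.
  split=> [[A finA KA0]|].
    apply/infK/(sub_finite_set _ finA) => _ [x Kx <-].
    by apply: contrapT => nAfx; apply: (KA0 x).
  split=> [|B B' [A finA KAB] [A' finA' KAB']|B B' BB' [A finA KAB]].
  - by exists set0; [exact: finite_set0|].
  - exists (A `|` A'); first by rewrite finite_setU.
    move=> x [Kx nAx]; split; [apply: KAB|apply: KAB']; split=> // Ax.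
      by apply: nAx; left.
    by apply: nAx; right.
  - by exists A => //; apply: subset_trans BB'.
have cofinK : cofin K by exists set0; [exact: finite_set0|move=> x []].
have [p [_ clp]] := cK cofin cofin_proper cofinK.
(* The fibre through [p] is a neighbourhood of [p], yet its complement belongs to [cofin]. *)
have cofin_p : cofin (~` (f @^-1` [set f p])).
  by exists [set f p]; [exact: finite_set1|move=> x []].
by have [x [nfx fx]] := clp _ _ cofin_p (fconst p).
Qed.

(** Each summand is open in the disjoint union, so the index is locally constant. *)
Lemma sigT_compact_finite_projT1 {I : choiceType} {T : I -> topologicalType}
    (K : set {i & T i}) :
  compact K -> finite_set ((@projT1 I T) @` K).
Proof.
apply: compact_locally_constant_finite => -[i x].
exact: (@filterS _ (nbhs x) _ setT _ _ filterT).
Qed.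

(** A nonempty fibre is a coset of the kernel of [rho], which lies in the stabiliser of any point
    [x] of the domain; properness at the compact set [[set x]] makes that stabiliser finite. *)
Lemma domain_finite_fibre {R : realType} {n : nat} {G : lieGroupType R n}
    {Gamma : groupType} {rho : {multiplicative Gamma -> G}} {H : set G}
    (Omega : domain_of_discontinuity rho H) (g : G) :
  finite_set (rho @^-1` [set g]).
Proof.
have [x Ox] := dod_nonempty Omega.
have [[gamma0 rho0]|nex] := pselect (exists gamma, rho gamma = g); last first.
  rewrite (_ : _ @^-1` _ = set0) // -subset0 => gamma /= rhog.
  by apply: nex; exists gamma.
have xO : [set x] `<=` dod_set Omega by move=> _ ->.
have finx := dod_proper (@compact_set1 _ x) xO.
apply: sub_finite_set (finite_image (fun k => gamma0 * k)%g finx).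
move=> gamma /= rhog; exists (gamma0^-1 * gamma)%g; last by rewrite mulVKg.
exists x; split=> //; exists x => //.
by rewrite gmulfM rhoV rho0 rhog mulVg translate1.
Qed.

Theorem theorem1p1
    (R : realType) (n : nat) (G : lieGroupType R n)
    (Gamma : groupType) (S : seq Gamma)
    (X : metricType R) (F : flow_space S X)
    (Pp Pm H : set G) (rho : {multiplicative Gamma -> G})
    (Omega : domain_of_discontinuity rho H)
    (D0 : set_type (connections (Cinfty_dod (Om:=Omega)) id)) :
  semisimple G ->
  word_hyperbolic R S ->
  opposite_parabolics Pp Pm ->
  anosov F rho Pp Pm ->
  parabolic H \/ symmetric_subgroup H ->
  properly_discontinuous
    (fun gamma : Gamma => @conn_act R n G Gamma rho H Omega D0 (image_of rho gamma)).
Proof.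
move=> _ _ _ _ _ K cK; have finI := sigT_compact_finite_projT1 K cK.
(* If [gamma] moves [x] in [K] to a point of [K], then [rho gamma] is the index of the image divided
   by that of [x]. *)
have finQ := finite_image2 (fun g g' : image_group rho => (val g' / val g)%g)
  finI finI.
apply: sub_finite_set (bigcup_finite finQ
  (fun q _ => domain_finite_fibre Omega q)).
move=> gamma [_ [[x Kx <-] Kgx]]; exists (rho gamma) => //.
exists (projT1 x); first by exists x.
exists (image_mul (image_of rho gamma) (projT1 x)).
  by exists (conn_act (image_of rho gamma) x).
exact: mulgK.
Qed.
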